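(* Let $\mathcal{B}$ be a connected small category, let $b_0$ be a chosen base object of $\mathcal{B}$ and let $Q_{\mathcal{B}}:\mathcal{B}\to Q\mathcal{B}$ be the canonical functor to the category of fractions. Then the smash product $\mathcal{B}\#_{b_0}Q_{\mathcal{B}}$ with its canonical functor to $\mathcal{B}$, pointed by the object $(b_0,1_{b_0})$ in the fibre of $b_0$ (where $1_{b_0}$ is the identity of $b_0$ in $Q\mathcal{B}$), is the universal Galois covering of $\mathcal{B}$: it is a pointed Galois covering which covers uniquely every pointed Galois covering of $\mathcal{B}$, that is, for every pointed Galois covering $(F,c)$ of $(\mathcal{B},b_0)$ there is a unique morphism of pointed Galois coverings from it to $(F,c)$, and this morphism is a covering.
   Context: All categories are small. A category is connected if its underlying undirected graph has one connected component. The set of morphisms from $x$ to $y$ in a category $\mathcal{A}$ is denoted ${}_y\mathcal{A}_x$. Fundamental groupoid: $Q\mathcal{B}$ is the category of fractions obtained from $\mathcal{B}$ by formally inverting all morphisms: a groupoid with the same objects as $\mathcal{B}$, with a canonical functor $Q_{\mathcal{B}}:\mathcal{B}\to Q\mathcal{B}$, the identity on objects, such that any functor $F:\mathcal{B}\to\mathcal{C}$ sending every morphism to an invertible morphism factors uniquely as $F=F'Q_{\mathcal{B}}$. Smash product: for a functor $X:\mathcal{B}\to\mathcal{G}$ to a groupoid and an object $x_0$ of $\mathcal{G}$, the category $\mathcal{B}\#_{x_0}X$ has as objects the pairs $(b,\gamma)$ with $b$ an object of $\mathcal{B}$ and $\gamma\in{}_{x_0}\mathcal{G}_{Xb}$;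 a morphism from $(b,\gamma)$ to $(c,\delta)$ is a morphism $f\in{}_c\mathcal{B}_b$ with $\delta X(f)=\gamma$; composition is that of $\mathcal{B}$. The canonical functor $F_X:\mathcal{B}\#_{x_0}X\to\mathcal{B}$ sends $(b,\gamma)$ to $b$ and a morphism $f$ to $f$. Coverings: the source star (resp. target star) at an object is the set of morphisms with that source (resp. target); the star is the disjoint union of both. A functor $F:\mathcal{C}\to\mathcal{B}$ is a covering if it is surjective on objects and, for each object $c$ of $\mathcal{C}$, induces a bijection from the star at $c$ to the star at $Fc$ (equivalently, bijections between corresponding source stars and between corresponding target stars). $\mathbf{Aut}\,F$ is the group of invertible functors $H:\mathcal{C}\to\mathcal{C}$ with $FH=F$. $F$ is a Galois covering if $\mathcal{C}$ is connected and $\mathbf{Aut}\,F$ acts transitively on the objects of some (equivalently any) fibre of $F$. A pointed Galois covering of $(\mathcal{B},b_0)$ is a pair $(F,c)$ with $F:\mathcal{C}\to\mathcal{B}$ a Galois covering and $c$ an object of $\mathcal{C}$ with $Fc=b_0$; a morphism $(F,c)\to(G,d)$, with $G:\mathcal{D}\to\mathcal{B}$, is a functor $H:\mathcal{C}\to\mathcal{D}$ with $GH=F$ and $Hc=d$. *)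

(* Defs.v *)
From Stdlib Require Import ssreflect ssrfun Relation_Operators.
From Stdlib Require Import FunctionalExtensionality PropExtensionality.
From Stdlib Require Import ProofIrrelevance IndefiniteDescription.

Set Implicit Arguments.
Unset Strict Implicit.
Unset Printing Implicit Defensive.

(* [hom x y] is the set of morphisms from x to y, and [cmp g f] is g after f.
   All categories live in one fixed universe: they are small. *)
Record category := Category {
  ob :> Type;
  hom : ob -> ob -> Type;
  idm : forall x, hom x x;
  cmp : forall x y z, hom y z -> hom x y -> hom x z;
  cmp_idl : forall x y (f : hom x y), cmp (idm y) f = f;
  cmp_idr : forall x y (f : hom x y), cmp f (idm x) = f;
  cmp_assoc : forall w x y z (h : hom y z) (g : hom x y) (f : hom w x),
    cmp h (cmp g f) = cmp (cmp h g) f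
}.

Arguments hom {_} _ _.
Arguments idm {_} _.
Arguments cmp {_ _ _ _} _ _.

Definition invertible (A : category) (x y : A) (f : hom x y) : Prop :=
  exists g : hom y x, cmp g f = idm x /\ cmp f g = idm y.

Record groupoid := Groupoid {
  gcat :> category;
  grp_inv : forall (x y : gcat) (f : hom x y), invertible f
}.

(* Functors are compared with Leibniz equality; the law fields do not matter,
   by proof irrelevance. *)
Record functor (A B : category) := Functor {
  fob :> A -> B;
  fmap : forall x y : A, hom x y -> hom (fob x) (fob y);
  fmap_id : forall x, fmap (idm x) = idm (fob x);
  fmap_cmp : forall x y z (g : hom y z) (f : hom x y),
    fmap (cmp g f) = cmp (fmap g) (fmap f)
}.

Arguments fmap {_ _} _ {_ _} _.

Lemma functor_eq (A B : category) (o : A -> B)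
    (m m' : forall x y : A, hom x y -> hom (o x) (o y)) i i' c c' :
  (forall x y (f : hom x y), m x y f = m' x y f) ->
  @Functor A B o m i c = @Functor A B o m' i' c'.
Proof.
move=> e.
have {}e : m = m'.
  apply: functional_extensionality_dep => x.
  apply: functional_extensionality_dep => y.
  exact: functional_extensionality.
by case: _ / e i' c' => i' c'; rewrite (proof_irrelevance _ i i')
  (proof_irrelevance _ c c').
Qed.

Definition functor_id (A : category) : functor A A.
Proof. by refine (@Functor A A (fun x => x) (fun x y f => f) _ _). Defined.

Definition functor_comp (A B C : category) (G : functor B C) (F : functor A B) :
  functor A C.
Proof.
refine (@Functor A C (fun x => G (F x)) (fun x y f => fmap G (fmap F f)) _ _).
- by move=> x; rewrite !fmap_id.
- by move=> x y z g f; rewrite !fmap_cmp.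
Defined.

Definition invertible_functor (A B : category) (F : functor A B) : Prop :=
  exists G : functor B A,
    functor_comp G F = functor_id A /\ functor_comp F G = functor_id B.

Definition connected (A : category) : Prop :=
  inhabited A /\
  forall x y : A,
    clos_refl_sym_trans A (fun a b => inhabited (hom a b)) x y.

Section Fractions.
Variable B : category.

(* Formal composites of morphisms of B and of formal inverses of morphisms
   of B, to be taken modulo the relation [feq] below. *)
Inductive fterm : B -> B -> Type :=
| fone x : fterm x x
| fgen x y : hom x y -> fterm x y
| finv x y : hom x y -> fterm y x
| fcmp x y z : fterm y z -> fterm x y -> fterm x z.

Inductive feq : forall x y, fterm x y -> fterm x y -> Prop :=
| feq_refl x y (t : fterm x y) : feq t t
| feq_sym x y (t u : fterm x y) : feq t u -> feq u t
| feq_trans x y (t u v : fterm x y) : feq t u -> feq u v -> feq t v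
| feq_cmp x y z (t t' : fterm y z) (u u' : fterm x y) :
    feq t t' -> feq u u' -> feq (fcmp t u) (fcmp t' u')
| feq_idl x y (t : fterm x y) : feq (fcmp (fone y) t) t
| feq_idr x y (t : fterm x y) : feq (fcmp t (fone x)) t
| feq_assoc w x y z (t : fterm y z) (u : fterm x y) (v : fterm w x) :
    feq (fcmp t (fcmp u v)) (fcmp (fcmp t u) v)
| feq_gen_id x : feq (fgen (idm x)) (fone x)
| feq_gen_cmp x y z (g : hom y z) (f : hom x y) :
    feq (fgen (cmp g f)) (fcmp (fgen g) (fgen f))
| feq_invl x y (f : hom x y) : feq (fcmp (finv f) (fgen f)) (fone x)
| feq_invr x y (f : hom x y) : feq (fcmp (fgen f) (finv f)) (fone y).

(* Quotient by [feq], as the type of its equivalence classes. *)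
Definition fhom (x y : B) : Type :=
  {P : fterm x y -> Prop | exists t, P = feq t}.

Definition fcls x y (t : fterm x y) : fhom x y :=
  exist _ (feq t) (ex_intro _ t erefl).

Definition frepr x y (p : fhom x y) : fterm x y :=
  proj1_sig (constructive_indefinite_description _ (proj2_sig p)).

Lemma freprK x y (p : fhom x y) : fcls (frepr p) = p.
Proof.
rewrite /frepr; case: constructive_indefinite_description => t /=.
case: p => P ? /= e.
by apply: subset_eq_compat; rewrite -e.
Qed.

Lemma fcls_eq x y (t u : fterm x y) : feq t u -> fcls t = fcls u.
Proof.
move=> e; apply: subset_eq_compat; apply: functional_extensionality => v.
apply: propositional_extensionality; split=> h.
- exact: feq_trans (feq_sym e) h.
- exact: feq_trans e h.
Qed.

Lemma fcls_inj x y (t u : fterm x y) : fcls t = fcls u -> feq t u.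
Proof.
move=> e; have -> : feq t = feq u by case: e.
exact: feq_refl.
Qed.

Lemma frepr_cls x y (t : fterm x y) : feq (frepr (fcls t)) t.
Proof. by apply: fcls_inj; exact: freprK. Qed.

Definition fhom_cmp x y z (p : fhom y z) (q : fhom x y) : fhom x z :=
  fcls (fcmp (frepr p) (frepr q)).

Lemma fhom_cmpE x y z (t : fterm y z) (u : fterm x y) :
  fhom_cmp (fcls t) (fcls u) = fcls (fcmp t u).
Proof. by apply/fcls_eq/feq_cmp; exact: frepr_cls. Qed.

Definition fractions_cat : category.
Proof.
refine (@Category B fhom (fun x => fcls (fone x)) fhom_cmp _ _ _).
- move=> x y p; rewrite -(freprK p) fhom_cmpE.
  by apply: fcls_eq; exact: feq_idl.
- move=> x y p; rewrite -(freprK p) fhom_cmpE.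
  by apply: fcls_eq; exact: feq_idr.
- move=> w x y z p q r; rewrite -(freprK p) -(freprK q) -(freprK r) !fhom_cmpE.
  by apply: fcls_eq; exact: feq_assoc.
Defined.

Lemma fractions_invertible (x y : fractions_cat) (p : hom x y) : invertible p.
Proof.
rewrite -(freprK p); elim: (frepr p) => {x y p}.
- by move=> x; exists (fcls (fone x)); rewrite /= fhom_cmpE; split;
    apply: fcls_eq; exact: feq_idl.
- by move=> x y f; exists (fcls (finv f)); rewrite /= !fhom_cmpE; split;
    apply: fcls_eq; [exact: feq_invl|exact: feq_invr].
- by move=> x y f; exists (fcls (fgen f)); rewrite /= !fhom_cmpE; split;
    apply: fcls_eq; [exact: feq_invr|exact: feq_invl].
- move=> x y z t [t' [t't tt']] u [u' [u'u uu']].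
  have -> : fcls (fcmp t u) = @cmp fractions_cat _ _ _ (fcls t) (fcls u).
    by rewrite /= fhom_cmpE.
  exists (@cmp fractions_cat _ _ _ u' t'); split.
  + by rewrite cmp_assoc -(cmp_assoc u') t't cmp_idr.
  + by rewrite cmp_assoc -(cmp_assoc (fcls t : @hom fractions_cat _ _)) uu'
      cmp_idr.
Qed.

Definition fractions : groupoid :=
  @Groupoid fractions_cat fractions_invertible.

Definition fractions_functor : functor B fractions.
Proof.
refine (@Functor B fractions (fun x => x) (fun x y f => fcls (fgen f)) _ _).
- by move=> x; apply: fcls_eq; exact: feq_gen_id.
- by move=> x y z g f; rewrite /= fhom_cmpE; apply: fcls_eq;
    exact: feq_gen_cmp.
Defined.

End Fractions.

Lemma inverse_unique (A : category) (x y : A) (f : hom x y) (g h : hom y x) :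
  cmp g f = idm x -> cmp f h = idm y -> g = h.
Proof. by move=> gf fh; rewrite -(cmp_idr g) -fh cmp_assoc gf cmp_idl. Qed.

Theorem fractions_universal (B C : category) (F : functor B C) :
  (forall (x y : B) (f : hom x y), invertible (fmap F f)) ->
  exists! F' : functor (fractions B) C,
    functor_comp F' (fractions_functor B) = F.
Proof.
move=> Finv.
pose inv (x y : B) (f : hom x y) :=
  constructive_indefinite_description _ (Finv x y f).
pose ev := fix ev (x y : B) (t : fterm x y) : hom (F x) (F y) :=
  match t with
  | fone x => idm (F x)
  | fgen f => fmap F f
  | finv f => proj1_sig (inv _ _ f)
  | fcmp t u => cmp (ev _ _ t) (ev _ _ u)
  end.
have evE x y (t u : fterm x y) : feq t u -> ev x y t = ev x y u.
{ elim=> {x y t u} //=.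
  - by move=> x y t u v _ -> _ ->.
  - by move=> x y z t t' u u' _ -> _ ->.
  - by move=> x y t; rewrite cmp_idl.
  - by move=> x y t; rewrite cmp_idr.
  - by move=> w x y z t u v; rewrite cmp_assoc.
  - by move=> x; rewrite fmap_id.
  - by move=> x y z g f; rewrite fmap_cmp.
  - by move=> x y f; case: (proj2_sig (inv _ _ f)).
  - by move=> x y f; case: (proj2_sig (inv _ _ f)). }
have F'1 (x : B) : ev _ _ (frepr (fcls (fone x))) = idm (F x).
  exact: evE (frepr_cls _).
have F'M (x y z : B) (p : fhom y z) (q : fhom x y) :
    ev _ _ (frepr (fhom_cmp p q)) = cmp (ev _ _ (frepr p)) (ev _ _ (frepr q)).
  exact: evE (frepr_cls _).
exists (@Functor (fractions B) C F (fun x y p => ev x y (frepr p)) F'1 F'M).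
split.
- case: F Finv @inv @ev evE F'1 F'M => o m i c Finv inv ev evE F'1 F'M.
  apply: functor_eq => x y f /=.
  exact: evE (frepr_cls _).
- move=> G e; subst F; case: G Finv @inv @ev evE F'1 F'M => o m i c.
  move=> Finv inv ev evE F'1 F'M; apply: functor_eq => x y p.
  rewrite -[in RHS](freprK p); elim: (frepr p) => {x y p} /=.
  + by move=> x; rewrite -(i x).
  + by [].
  + move=> x y f; case: (proj2_sig (inv _ _ f)) => /= gf _.
    apply: (inverse_unique gf); rewrite -c -i; congr (m _ _ _).
    by rewrite /= fhom_cmpE; apply: fcls_eq; exact: feq_invr.
  + by move=> x y z t -> u ->; rewrite -c /= fhom_cmpE.
Qed.

Section Smash.
Variables (B : category) (G : groupoid) (x0 : G) (X : functor B G).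

Record smash_ob := SmashOb {
  smash_base : B;
  smash_arrow : hom (X smash_base) x0
}.

Definition smash_hom (p q : smash_ob) : Type :=
  {f : hom (smash_base p) (smash_base q) |
    cmp (smash_arrow q) (fmap X f) = smash_arrow p}.

Lemma smash_hom_eq p q (f g : smash_hom p q) :
  proj1_sig f = proj1_sig g -> f = g.
Proof. by apply: eq_sig_hprop => ?; exact: proof_irrelevance. Qed.

Definition smash_id (p : smash_ob) : smash_hom p p.
Proof. by exists (idm (smash_base p)); rewrite fmap_id cmp_idr. Defined.

Definition smash_cmp p q r (g : smash_hom q r) (f : smash_hom p q) :
  smash_hom p r.
Proof.
exists (cmp (proj1_sig g) (proj1_sig f)).
by rewrite fmap_cmp cmp_assoc (proj2_sig g) (proj2_sig f).
Defined.

Definition smash : category.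
Proof.
refine (@Category smash_ob smash_hom smash_id smash_cmp _ _ _).
- by move=> p q f; apply: smash_hom_eq; exact: cmp_idl.
- by move=> p q f; apply: smash_hom_eq; exact: cmp_idr.
- by move=> p q r s h g f; apply: smash_hom_eq; exact: cmp_assoc.
Defined.

Definition smash_functor : functor smash B.
Proof.
by refine (@Functor smash B smash_base (fun p q f => proj1_sig f) _ _).
Defined.

End Smash.

Definition source_star (A : category) (x : A) : Type := {y : A & hom x y}.
Definition target_star (A : category) (x : A) : Type := {y : A & hom y x}.
Definition star (A : category) (x : A) : Type :=
  (source_star x + target_star x)%type.

Definition star_map (C B : category) (F : functor C B) (c : C) (s : star c) :
    star (F c) :=
  match s with
  | inl (existT _ d f) => inl (existT (fun b => hom (F c) b) (F d) (fmap F f))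
  | inr (existT _ d f) => inr (existT (fun b => hom b (F c)) (F d) (fmap F f))
  end.

Definition covering (C B : category) (F : functor C B) : Prop :=
  (forall b : B, exists c : C, F c = b) /\
  (forall c : C, bijective (@star_map C B F c)).

Definition Aut (C B : category) (F : functor C B) : Type :=
  {H : functor C C | invertible_functor H /\ functor_comp F H = F}.

Definition transitive_on_fibre (C B : category) (F : functor C B) (b : B) :
    Prop :=
  forall c c' : C, F c = b -> F c' = b ->
    exists H : Aut F, proj1_sig H c = c'.

Definition galois_covering (C B : category) (F : functor C B) : Prop :=
  covering F /\ connected C /\ exists b : B, transitive_on_fibre F b.

Definition pointed_galois_covering (B : category) (b0 : B) (C : category)
    (F : functor C B) (c : C) : Prop :=
  galois_covering F /\ F c = b0.

Definition pointed_morphism (B C D : category) (F : functor C B) (c : C)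
    (G : functor D B) (d : D) (H : functor C D) : Prop :=
  functor_comp G H = F /\ H c = d.

(* Main.v *)
Require Import Defs.
From Stdlib Require Import ssreflect ssrfun Relation_Operators.
From Stdlib Require Import FunctionalExtensionality.
From Stdlib Require Import ProofIrrelevance IndefiniteDescription.

(** Let [F : C -> B] be a covering. Lifting morphisms and formal inverses of
    morphisms along [F] makes the fundamental groupoid of [B] act on the fibres
    of [F] by bijections; the defining relations of the groupoid are respected
    because lifts are unique. A point [c] over [b0] and an arrow
    [gamma : b -> b0] of the groupoid thus determine a point over [b], the one
    carried to [c] by [gamma]: this is the value at [(b, gamma)] of the morphism
    to [(F, c)]. It is unique since two lifts of a functor with connected domain
    agree as soon as they agree at one object. The smash product itself is Galois
    because postcomposing the groupoid arrows with loops at [b0] is transitive on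
    its fibres. *)

Set Implicit Arguments.
Unset Strict Implicit.
Unset Printing Implicit Defensive.

(* Being an inductive family, this says [fmap F g = f] even when the endpoints
   of [f] are only provably equal to those of [fmap F g]. In particular,
   [lies_over (functor_id C)] is heterogeneous equality of morphisms. *)
Inductive lies_over (C B : category) (F : functor C B) (c d : C)
    (g : hom c d) : forall x y : B, hom x y -> Prop :=
| LiesOver : lies_over F g (fmap F g).

(** * Unique lifting of morphisms along a covering *)

Section LiesOver.
Variables (C B : category) (F : functor C B).

Lemma lies_over_source (c d : C) (g : hom c d) (x y : B) (f : hom x y) :
  lies_over F g f -> F c = x.
Proof. by case. Qed.

Lemma lies_over_target (c d : C) (g : hom c d) (x y : B) (f : hom x y) :
  lies_over F g f -> F d = y.
Proof. by case. Qed.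

Lemma lies_over_cast (c d : C) (g : hom c d) (x y : B) (f : hom x y) :
  lies_over F g f -> forall (ex : F c = x) (ey : F d = y),
  f = eq_rect _ (fun x => hom x y) (eq_rect _ (hom (F c)) (fmap F g) _ ey) _ ex.
Proof.
case=> ex ey.
by rewrite (proof_irrelevance _ ex erefl) (proof_irrelevance _ ey erefl).
Qed.

Lemma lies_over_fmap (c d : C) (g : hom c d) (f : hom (F c) (F d)) :
  lies_over F g f -> f = fmap F g.
Proof. by move=> h; rewrite (lies_over_cast h erefl erefl). Qed.

Lemma lies_over_source_star (c d : C) (g : hom c d) (y : B) (f : hom (F c) y) :
  lies_over F g f ->
  existT (fun b => hom (F c) b) y f = existT (fun b => hom (F c) b) _ (fmap F g).
Proof.
move=> h; move: (lies_over_target h) => e.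
by case: y / e f h => f /lies_over_fmap ->.
Qed.

Lemma lies_over_target_star (c d : C) (g : hom c d) (x : B) (f : hom x (F d)) :
  lies_over F g f ->
  existT (fun b => hom b (F d)) x f = existT (fun b => hom b (F d)) _ (fmap F g).
Proof.
move=> h; move: (lies_over_source h) => e.
by case: x / e f h => f /lies_over_fmap ->.
Qed.

Lemma lies_over_idm (c : C) (x : B) : F c = x -> lies_over F (idm c) (idm x).
Proof. by move=> <-; rewrite -fmap_id. Qed.

Lemma lies_over_cmp (c d e : C) (h : hom d e) (g : hom c d)
    (x y z : B) (k : hom y z) (f : hom x y) :
  lies_over F g f -> lies_over F h k -> lies_over F (cmp h g) (cmp k f).
Proof.
move=> gf hk.
have ex := lies_over_source gf; have ey := lies_over_source hk.
have ez := lies_over_target hk.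
case: x / ex f gf => f gf; case: y / ey k f hk gf => k f hk gf.
case: z / ez k hk => k hk.
by rewrite (lies_over_fmap gf) (lies_over_fmap hk) -fmap_cmp.
Qed.

Hypothesis covF : covering F.

Lemma lift_source (x y : B) (f : hom x y) (c : C) :
  F c = x -> exists d (g : hom c d), lies_over F g f.
Proof.
move=> e; case: x / e f => f.
have [_ /(_ c) [r _ rK]] := covF.
move: (rK (inl (existT _ y f))); case: (r _) => [] [d g] //= [] _ e.
(* Writing [f] as a second projection allows rewriting with the equality of pairs [e]. *)
have gf : lies_over F g (projT2 (existT (hom (F c)) y f)) by rewrite -e.
by exists d, g.
Qed.

Lemma lift_target (x y : B) (f : hom x y) (d : C) :
  F d = y -> exists c (g : hom c d), lies_over F g f.
Proof.
move=> e; case: y / e f => f.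
have [_ /(_ d) [r _ rK]] := covF.
move: (rK (inr (existT _ x f))); case: (r _) => [] [c g] //= [] _ e.
have gf : lies_over F g (projT2 (existT (hom^~ (F d)) x f)) by rewrite -e.
by exists c, g.
Qed.

(** Injectivity on source stars. The targets [d] and [d'] are not known to agree, hence the
    heterogeneous conclusion; [lies_over_target] then extracts [d = d'] from it. *)
Lemma lift_source_unique (x y : B) (f : hom x y) (c d c' d' : C)
    (g : hom c d) (g' : hom c' d') :
  lies_over F g f -> lies_over F g' f -> c = c' ->
  lies_over (functor_id C) g g'.
Proof.
move=> gf g'f e; case: c' / e g' g'f => g' g'f.
have e := lies_over_source gf; case: x / e f gf g'f => f gf g'f.
have [_ /(_ c) /bij_inj inj] := covF.
have e : existT (hom c) d g = existT (hom c) d' g'.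
  have [] // : @inl _ (target_star c) (existT (hom c) d g)
             = inl (existT (hom c) d' g').
  apply: inj => /=.
  by rewrite -(lies_over_source_star gf) -(lies_over_source_star g'f).
suff : lies_over (functor_id C) g (projT2 (existT (hom c) d' g')) by [].
by rewrite -e; exact: (LiesOver (functor_id C)).
Qed.

Lemma lift_target_unique (x y : B) (f : hom x y) (c d c' d' : C)
    (g : hom c d) (g' : hom c' d') :
  lies_over F g f -> lies_over F g' f -> d = d' ->
  lies_over (functor_id C) g g'.
Proof.
move=> gf g'f e; case: d' / e g' g'f => g' g'f.
have e := lies_over_target gf; case: y / e f gf g'f => f gf g'f.
have [_ /(_ d) /bij_inj inj] := covF.
have e : existT (hom^~ d) c g = existT (hom^~ d) c' g'.
  have [] // : @inr (source_star d) _ (existT (hom^~ d) c g)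
             = inr (existT (hom^~ d) c' g').
  apply: inj => /=.
  by rewrite -(lies_over_target_star gf) -(lies_over_target_star g'f).
suff : lies_over (functor_id C) g (projT2 (existT (hom^~ d) c' g')) by [].
by rewrite -e; exact: (LiesOver (functor_id C)).
Qed.

End LiesOver.

(** * Uniqueness of lifted functors, and cancellation of coverings *)

(** Agreement on objects is read off from the identity morphisms; after that, the heterogeneous
    hypothesis becomes an equation. *)
Lemma functor_ext (C B : category) (F G : functor C B) :
  (forall (c d : C) (g : hom c d), lies_over F g (fmap G g)) -> G = F.
Proof.
case: F => o m i k; case: G => o' m' i' k' /= h.
have e : o = o'.
  apply: functional_extensionality => c.
  exact: lies_over_source (h c c (idm c)).
case: o' / e m' i' k' h => m' i' k' h.
by apply: functor_eq => c d g; exact: lies_over_fmap (h c d g).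
Qed.

Lemma lift_unique (C B : category) (F : functor C B) (x y : B)
    (f : hom x y) (c d : C) (g g' : hom c d) :
  covering F -> lies_over F g f -> lies_over F g' f -> g = g'.
Proof.
move=> covF gf g'f.
by rewrite (lies_over_fmap (lift_source_unique covF gf g'f erefl)).
Qed.

Lemma functor_lift_unique (U C B : category) (F : functor C B)
    (H H' : functor U C) (u : U) :
  covering F -> connected U -> functor_comp F H = functor_comp F H' ->
  H u = H' u -> H = H'.
Proof.
move=> covF [_ conU] e eu.
have over (x y : U) (f : hom x y) :
    lies_over F (fmap H' f) (fmap (functor_comp F H) f).
  by rewrite e; exact: LiesOver.
have over' (x y : U) (f : hom x y) :
    lies_over F (fmap H f) (fmap (functor_comp F H) f) by exact: LiesOver.
(* Agreement at one end of a morphism gives agreement at the other, by unique lifting from the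
   source or from the target; as an equivalence, this passes along zigzags. *)
have step (x y : U) : clos_refl_sym_trans U (fun a b => inhabited (hom a b)) x y ->
    H x = H' x <-> H y = H' y.
{ elim=> {x y} [x y [f]||x y _ ->|x y z _ -> _ ->] //; split=> exy.
  - exact: lies_over_target (lift_source_unique covF (over' _ _ f) (over _ _ f) exy).
  - exact: lies_over_source (lift_target_unique covF (over' _ _ f) (over _ _ f) exy). }
have obE x : H x = H' x by apply/(step _ _ (conU u x)).
apply: functor_ext => x y f.
have h := lift_source_unique covF (over _ _ f) (over' _ _ f) (esym (obE x)).
by case: h; exact: LiesOver.
Qed.

(** Star maps compose, so [H] is bijective on stars by two-out-of-three. Its image is nonempty and,
    by surjectivity on stars, closed under neighbours, so it exhausts the connected [C]. *)
Lemma covering_cancel (U C B : category) (F : functor C B) (H : functor U C) :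
  covering F -> covering (functor_comp F H) -> inhabited U -> connected C ->
  covering H.
Proof.
move=> [_ starF] [_ starFH] [u] [_ conC].
have starH x : bijective (@star_map _ _ H x).
  have [r rK Kr] := starFH x.
  have starE s : star_map (functor_comp F H) s = star_map F (star_map H s).
    by case: s => [] [].
  exists (fun t => r (star_map F t)) => s; first by rewrite -starE rK.
  by apply: (bij_inj (starF (H x))); rewrite -starE Kr.
split=> // d.
have step (x y : C) : clos_refl_sym_trans C (fun a b => inhabited (hom a b)) x y ->
    (exists a, H a = x) <-> (exists a, H a = y).
{ elim=> {x y} [x y [f]||x y _ ->|x y z _ -> _ ->] //; split=> -[a e].
  - case: x / e f => f; have [r _ rK] := starH a.
    move: (rK (inl (existT _ y f))); case: (r _) => [] [b g] //= [] eb _.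
    by exists b.
  - case: y / e f => f; have [r _ rK] := starH a.
    move: (rK (inr (existT _ x f))); case: (r _) => [] [b g] //= [] eb _.
    by exists b. }
by apply/(step _ _ (conC (H u) d)); exists u.
Qed.

(** * Action of the fundamental groupoid on the fibres *)

Section Transport.
Variables (C B : category) (F : functor C B).

(** A relation rather than a map between fibres: this avoids choosing lifts and casting along
    equations of objects. *)
Fixpoint transport (x y : B) (t : fterm x y) : C -> C -> Prop :=
  match t with
  | fone x => fun c d => F c = x /\ c = d
  | fgen f => fun c d => exists g : hom c d, lies_over F g f
  | finv f => fun c d => exists g : hom d c, lies_over F g f
  | fcmp t u => fun c d => exists e, transport u c e /\ transport t e d
  end.

Lemma transport_source (x y : B) (t : fterm x y) (c d : C) :
  transport t c d -> F c = x.
Proof.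
elim: t c d => {x y} [x|x y f|x y f|x y z t _ u IHu] c d /=.
- by case.
- by case=> g /lies_over_source.
- by case=> g /lies_over_target.
- by case=> e [/IHu].
Qed.

Lemma transport_target (x y : B) (t : fterm x y) (c d : C) :
  transport t c d -> F d = y.
Proof.
elim: t c d => {x y} [x|x y f|x y f|x y z t IHt u _] c d /=.
- by case=> <- ->.
- by case=> g /lies_over_target.
- by case=> g /lies_over_source.
- by case=> e [_ /IHt].
Qed.

Hypothesis covF : covering F.

(** With [transport_inj], this makes the starting point a function of the end point. That direction
    is the useful one: the arrow of a smash object ends at the base object, over which the given
    point lies. *)
Lemma transport_inv (x y : B) (t : fterm x y) (d : C) :
  F d = y -> exists c, transport t c d.
Proof.
elim: t d => {x y} [x|x y f|x y f|x y z t IHt u IHu] d e /=.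
- by exists d.
- by have [c [g gf]] := lift_target covF f e; exists c, g.
- by have [c [g gf]] := lift_source covF f e; exists c, g.
- have [c tcd] := IHt d e; have [b ubc] := IHu c (transport_source tcd).
  by exists b, c.
Qed.

Lemma transport_inj (x y : B) (t : fterm x y) (c c' d : C) :
  transport t c d -> transport t c' d -> c = c'.
Proof.
elim: t c c' d => {x y} [x|x y f|x y f|x y z t IHt u IHu] c c' d /=.
- by case=> _ -> [_ ->].
- case=> g gf [g' g'f].
  exact: lies_over_source (lift_target_unique covF gf g'f erefl).
- case=> g gf [g' g'f].
  exact: lies_over_target (lift_source_unique covF gf g'f erefl).
- case=> e [uce ted] [e' [uce' ted']].
  rewrite -(IHt _ _ _ ted ted') in uce'; exact: IHu uce uce'.
Qed.

Lemma transport_feq (x y : B) (t u : fterm x y) :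
  feq t u -> forall c d, transport t c d <-> transport u c d.
Proof.
elim=> {x y t u} //=.
- by move=> x y t u _ IH c d; rewrite IH.
- by move=> x y t u v _ IH _ IH' c d; rewrite IH IH'.
- move=> x y z t t' u u' _ IH _ IH' c d.
  by split=> -[e [/IH' ? /IH ?]]; exists e.
- move=> x y t c d; split=> [[e [tce [_ <-]]] //|tcd].
  by exists d; split=> //; split=> //; exact: transport_target tcd.
- move=> x y t c d; split=> [[e [[_ <-]]] //|tcd].
  by exists c; split=> //; split=> //; exact: transport_source tcd.
- move=> w x y z t u v c d; split.
  + by case=> e [[e' [? ?]] ?]; exists e'; split=> //; exists e.
  + by case=> e [? [e' [? ?]]]; exists e'; split=> //; exists e.
- move=> x c d; split.
  + case=> g gx; have e := lies_over_source gx; split=> //.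
    have h := lift_source_unique covF (lies_over_idm e) gx erefl.
    exact: lies_over_target h.
  + by case=> e <-; exists (idm c); exact: lies_over_idm.
- move=> x y z g f c d; split.
  + case=> h hgf.
    (* Lift [f], then [g]; by uniqueness the composite of the two lifts agrees with [h], so it ends
       at [d]. *)
    have [e [f' f'f]] := lift_source covF f (lies_over_source hgf).
    have [d' [g' g'g]] := lift_source covF g (lies_over_target f'f).
    have ed := lies_over_target
      (lift_source_unique covF (lies_over_cmp f'f g'g) hgf erefl).
    case: d / ed h hgf => h hgf.
    by exists e; split; [exists f'|exists g'].
  + by case=> e [[f' f'f] [g' g'g]]; exists (cmp g' f'); exact: lies_over_cmp.
- move=> x y f c d; split.
  + case=> e [[g gf] [g' g'f]]; split; first exact: lies_over_source gf.
    exact: lies_over_source (lift_target_unique covF gf g'f erefl).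
  + case=> ec <-; have [e [g gf]] := lift_source covF f ec.
    by exists e; split; exists g.
- move=> x y f c d; split.
  + case=> e [[g gf] [g' g'f]]; split; first exact: lies_over_target gf.
    exact: lies_over_target (lift_source_unique covF gf g'f erefl).
  + case=> ec <-; have [e [g gf]] := lift_target covF f ec.
    by exists e; split; exists g.
Qed.

End Transport.

(** * The morphism to a pointed covering *)

Lemma smash_lift (B C : category) (b0 : B) (F : functor C B) (c : C) :
  covering F -> F c = b0 ->
  exists H : functor (smash (b0 : fractions B) (fractions_functor B)) C,
    pointed_morphism (smash_functor (b0 : fractions B) (fractions_functor B))
      (@SmashOb B (fractions B) b0 (fractions_functor B) b0
        (idm (b0 : fractions B))) F c H.
Proof.
move=> covF ec.
set U := smash _ _.
pose obP (p : U) := constructive_indefinite_description _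
  (transport_inv covF (frepr (smash_arrow p)) ec).
pose o p := proj1_sig (obP p).
have oP (p : U) : transport F (frepr (smash_arrow p)) (o p) c := proj2_sig (obP p).
have mP (p q : U) (f : hom p q) :
    exists g : hom (o p) (o q), lies_over F g (proj1_sig f).
  (* The arrow at [p] is the arrow at [q] after [f]. So transport from [o p] to [c] splits as a lift
     of [f] ending at some [e], then transport from [e] to [c]; injectivity forces [e = o q]. *)
  case: f => f ef /=; have := oP p; rewrite -ef /=.
  rewrite -{1}(freprK (smash_arrow q)) fhom_cmpE.
  move/(transport_feq covF (frepr_cls _)) => /= [e [[g gf] qec]].
  have ee := transport_inj covF qec (oP q).
  by case: _ / ee; exists g.
pose mE p q f := constructive_indefinite_description _ (mP p q f).
pose m p q f := proj1_sig (mE p q f).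
have mf p q f : lies_over F (m p q f) (proj1_sig f) := proj2_sig (mE p q f).
have m1 p : m p p (idm p) = idm (o p).
  apply: (lift_unique covF (mf _ _ _)).
  exact/lies_over_idm/(transport_source (oP p)).
have mM p q r (g : hom q r) (f : hom p q) :
    m p r (cmp g f) = cmp (m q r g) (m p q f).
  by apply: (lift_unique covF (mf _ _ _)); exact: lies_over_cmp.
exists (@Functor U C o m m1 mM); split.
- apply/esym/functor_ext => p q f /=.
  by case: (mf p q f); exact: (LiesOver (functor_comp F (Functor m1 mM))).
- have /= := oP (@SmashOb B (fractions B) b0 (fractions_functor B) b0
        (idm (b0 : fractions B))).
  (* The identity is the class of [fone b0], whose transport relates only equal points. *)
  by move/(transport_feq covF (frepr_cls _)) => [].
Qed.

(** * The smash product as a Galois covering *)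

Lemma inj_surj_bij (T S : Type) (f : T -> S) :
  injective f -> (forall s, exists t, f t = s) -> bijective f.
Proof.
move=> inj surj; pose r s := constructive_indefinite_description _ (surj s).
exists (fun s => proj1_sig (r s)) => x; last exact: proj2_sig (r x).
exact/inj/(proj2_sig (r (f x))).
Qed.

Lemma groupoid_cancelr (G : groupoid) (x y z : G) (f : hom x y)
    (g h : hom y z) : cmp g f = cmp h f -> g = h.
Proof.
have [f' [_ ff']] := grp_inv f => e.
by rewrite -(cmp_idr g) -ff' cmp_assoc e -cmp_assoc ff' cmp_idr.
Qed.

Section SmashGalois.
Variables (B : category) (G : groupoid) (x0 : G) (X : functor B G).

(** A morphism [f] of [B] and the arrow at one end determine the arrow at the other: composing with
    [X f] gives the source arrow, composing with its inverse gives the target arrow. *)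
Lemma smash_covering :
  (forall b : B, inhabited (hom (X b) x0)) -> covering (smash_functor x0 X).
Proof.
move=> inhX; split=> [b|[b ga]].
  by have [ga] := inhX b; exists (SmashOb ga).
apply: inj_surj_bij.
- move=> [[[y de] f]|[[y de] f]] [[[y' de'] f']|[[y' de'] f']] //= [].
  + move=> ey; case: y' / ey de' f' => de' f' /(inj_pair2 _ _ _ _ _) ef.
    have ede : de = de'.
      apply: (groupoid_cancelr (f := fmap X (proj1_sig f))).
      by rewrite {2}ef (proj2_sig f) (proj2_sig f').
    by case: de' / ede f' ef => f' ef; rewrite (smash_hom_eq (f := f) (g := f') ef).
  + move=> ey; case: y' / ey de' f' => de' f' /(inj_pair2 _ _ _ _ _) ef.
    have ede : de = de'.
      move: (proj2_sig f) (proj2_sig f'); rewrite -ef /=.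
      by move=> -> ->.
    by case: de' / ede f' ef => f' ef; rewrite (smash_hom_eq (f := f) (g := f') ef).
- case=> [] [y f] /=.
  + have [h [hf _]] := grp_inv (fmap X f).
    have e : cmp (cmp ga h) (fmap X f) = ga by rewrite -cmp_assoc hf cmp_idr.
    by exists (inl (existT _ (SmashOb (cmp ga h) : smash x0 X) (exist _ f e))).
  + by exists (inr (existT _ (SmashOb (cmp ga (fmap X f)) : smash x0 X)
      (exist _ f erefl))).
Qed.

Lemma smash_lies_over_id (b y : B) (ga ga' : hom (X b) x0)
    (de de' : hom (X y) x0)
    (f : @hom (smash x0 X) (SmashOb ga) (SmashOb de))
    (f' : @hom (smash x0 X) (SmashOb ga') (SmashOb de')) :
  ga = ga' -> de = de' -> proj1_sig f = proj1_sig f' ->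
  lies_over (functor_id (smash x0 X)) f f'.
Proof.
move=> ega ede; case: ga' / ega f'; case: de' / ede => f' ef.
have <- : f = f' by exact: smash_hom_eq.
exact: (LiesOver (functor_id (smash x0 X))).
Qed.

(** Composing with [tau] on the left commutes with composing with [X f] on the right, so the
    underlying morphisms can be kept. *)
Definition smash_translate (tau : hom x0 x0) :
  functor (smash x0 X) (smash x0 X).
Proof.
refine (@Functor (smash x0 X) (smash x0 X)
  (fun p => SmashOb (cmp tau (smash_arrow p)))
  (fun p q f => exist _ (proj1_sig f) _) _ _).
Unshelve.
- by move=> p; exact: smash_hom_eq.
- by move=> p q r g f; exact: smash_hom_eq.
- by rewrite /= -cmp_assoc (proj2_sig f).
Defined.

Lemma smash_translateK (sigma tau : hom x0 x0) : cmp sigma tau = idm x0 ->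
  functor_comp (smash_translate sigma) (smash_translate tau) =
  functor_id (smash x0 X).
Proof.
move=> e; apply: functor_ext => -[b ga] [y de] f.
by apply: smash_lies_over_id => //=; rewrite cmp_assoc e cmp_idl.
Qed.

Lemma smash_transitive (b : B) : transitive_on_fibre (smash_functor x0 X) b.
Proof.
move=> [b1 ga] [b2 de] /= e1 e2; subst b2; case: b / e1 de => de.
have [ga' [gaK gaV]] := grp_inv ga; have [de' [deK deV]] := grp_inv de.
(* [tau] is the loop at [x0] that carries [ga] to [de]; [sigma] is its inverse. *)
pose tau := cmp de ga'; pose sigma := cmp ga de'.
have st : cmp sigma tau = idm x0.
  by rewrite /sigma /tau cmp_assoc -(cmp_assoc ga) deK cmp_idr.
have ts : cmp tau sigma = idm x0.
  by rewrite /sigma /tau cmp_assoc -(cmp_assoc de) gaK cmp_idr.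
have autT : invertible_functor (smash_translate tau) /\
    functor_comp (smash_functor x0 X) (smash_translate tau) = smash_functor x0 X.
  split; last exact: functor_eq.
  by exists (smash_translate sigma); split; exact: smash_translateK.
exists (exist _ (smash_translate tau) autT) => /=.
by rewrite /tau -cmp_assoc gaK cmp_idr.
Qed.

End SmashGalois.

(** * Connectedness of the smash product over the fundamental groupoid *)

Lemma connected_fterm (B : category) (x y : B) :
  connected B -> inhabited (fterm x y).
Proof.
move=> [_ /(_ x y)] con.
(* Terms in both directions are built at once, so that the symmetric case of the zigzag is
   immediate. *)
suff [] : inhabited (fterm x y) /\ inhabited (fterm y x) by [].
elim: con => {x y} [x y [f]|x|x y _ []|x y z _ [[t] [t']] _ [[u] [u']]] //.
- by split; constructor; [exact: fgen f|exact: finv f].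
- by split; constructor; exact: fone.
- by split; constructor; [exact: fcmp u t|exact: fcmp t' u'].
Qed.

(** A term representing [gamma : b -> b0] is a zigzag in [B]; lifting it step by step joins
    [(b, gamma)] to [(b0, 1)]. *)
Lemma smash_fractions_connected (B : category) (b0 : B) :
  connected (smash (b0 : fractions B) (fractions_functor B)).
Proof.
set Q := fractions_functor B; set U := smash _ _.
pose conn := clos_refl_sym_trans U (fun p q => inhabited (hom p q)).
pose pt (b : B) (ga : @hom (fractions B) b b0) : U :=
  @SmashOb B (fractions B) b0 Q b ga.
have pt_gen (x y : B) (f : hom x y) (ga : @hom (fractions B) y b0) :
    conn (pt x (cmp ga (fmap Q f))) (pt y ga).
  by apply: rst_step; constructor; exists f.
have along (x y : B) (t : fterm x y) (ga : @hom (fractions B) y b0) :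
    conn (pt x (cmp ga (fcls t : @hom (fractions B) x y))) (pt y ga).
{ elim: t ga => {x y} [x|x y f|x y f|x y z t IHt u IHu] ga.
  - by rewrite [cmp _ _]cmp_idr; exact: rst_refl.
  - exact: pt_gen.
  (* A formal inverse runs against [f]: here [de] is [ga] after the inverse of [f], so [ga] is [de]
     after [f] and the generator case applies in reverse. *)
  - apply: rst_sym; set de := cmp ga _.
    have -> : ga = cmp de (fmap Q f); last exact: pt_gen.
    rewrite /de -cmp_assoc.
    have -> : cmp (fcls (finv f) : @hom (fractions B) _ _) (fmap Q f) = idm _.
      by rewrite /= fhom_cmpE; apply: fcls_eq; exact: feq_invl.
    by rewrite cmp_idr.
  - have -> : fcls (fcmp t u) = @cmp (fractions B) _ _ _ (fcls t) (fcls u).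
      by rewrite /= fhom_cmpE.
    by rewrite cmp_assoc; apply: rst_trans (IHu _) (IHt _). }
have base (p : U) : conn p (pt b0 (idm (b0 : fractions B))).
  case: p => b ga; have := along _ _ (frepr ga) (idm (b0 : fractions B)).
  by rewrite freprK cmp_idl.
split; first by constructor; exact: pt b0 (idm (b0 : fractions B)).
by move=> p q; apply: rst_trans (base p) (rst_sym _ _ _ _ (base q)).
Qed.

Theorem theorem5p6 (B : category) (b0 : B) (hB : connected B) :
  let Q := fractions_functor B in
  let U := smash (b0 : fractions B) Q in
  let FQ : functor U B := smash_functor (b0 : fractions B) Q in
  let u : U := @SmashOb B (fractions B) b0 Q b0 (idm (b0 : fractions B)) in
  pointed_galois_covering b0 FQ u /\
  forall (C : category) (F : functor C B) (c : C),
    pointed_galois_covering b0 F c ->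
    (exists! H : functor U C, pointed_morphism FQ u F c H) /\
    (forall H : functor U C, pointed_morphism FQ u F c H -> covering H).
Proof.
move=> Q U FQ u.
have covU : covering FQ.
  apply: smash_covering => b; have [t] := connected_fterm b b0 hB.
  by constructor; exact: fcls t.
have conU : connected U := smash_fractions_connected b0.
split.
  by split=> //; split=> //; split=> //; exists b0; exact: smash_transitive.
move=> C F c [[covF [conC _]] ec]; split.
  have [H [FH Hu]] := smash_lift covF ec.
  exists H; split=> // H' [FH' H'u].
  by apply: (functor_lift_unique (u := u) covF conU); rewrite ?FH ?Hu.
(* [F] after [H] is the covering [FQ], so cancelling [F] leaves a covering. *)
by move=> H [FH _]; apply: (covering_cancel covF) => //; rewrite FH.
Qed.
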